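(* Let $1\le p<\infty$ and $0\le\lambda<n$, and let $w$ be a weight on $\mathbb R^n$. If the Hardy–Littlewood maximal operator $M$ is bounded from $\mathcal L^{p,\lambda}(w)$ to $W\mathcal L^{p,\lambda}(w)$, then $w\in A_{p+\lambda/n}$.
   Context: A weight is a locally integrable function $w$ on $\mathbb R^n$ with $w>0$ a.e.; $w(A)=\int_A w$. $Mf(x)=\sup_{B\ni x}\frac1{|B|}\int_B|f|$, the supremum over Euclidean balls $B$ containing $x$. Boundedness means that there is $C$ with $\|Mf\|_{W\mathcal L^{p,\lambda}(w)}\le C\|f\|_{\mathcal L^{p,\lambda}(w)}$ for all $f\in\mathcal L^{p,\lambda}(w)$. Morrey norm: $\|f\|_{\mathcal L^{p,\lambda}(w)}=\sup_{x\in\mathbb R^n,\,r>0}\big(\frac1{r^\lambda}\int_{B(x,r)}|f|^p w\big)^{1/p}$, and $\mathcal L^{p,\lambda}(w)$ is the set of measurable $f$ with finite norm. Weak Morrey norm: $\|f\|_{W\mathcal L^{p,\lambda}(w)}=\sup_{x\in\mathbb R^n,\,r>0,\,t>0}\big(\frac{t^p\,w(\{y\in B(x,r):|f(y)|>t\})}{r^\lambda}\big)^{1/p}$. For $1<q<\infty$, $w\in A_q$ iff $\sup_B\frac{w(B)}{|B|}\big(\frac{w^{1-q'}(B)}{|B|}\big)^{q-1}<\infty$ over all balls, $1/q+1/q'=1$; $w\in A_1$ iff there is $c$ with $\frac{w(B)}{|B|}\le c\,w(x)$ for every ball $B$ and a.e. $x\in B$. *)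

(* Defs.v *)
From HB Require Import structures.
From mathcomp Require Import all_boot all_order all_algebra.
From mathcomp Require Import all_classical all_reals all_analysis.

Set Implicit Arguments.
Unset Strict Implicit.
Unset Printing Implicit Defensive.
Import Order.TTheory GRing.Theory Num.Theory.
Import numFieldNormedType.Exports.

Local Open Scope classical_set_scope.
Local Open Scope ring_scope.

Section cons_measure.
Context {R : realType} {n : nat}.
Local Notation R1 := (measurableTypeR R).
Variable mu : {sigma_finite_measure set (n.-tuple R1) -> \bar R}.

Definition tcons (xt : R1 * n.-tuple R1) : n.+1.-tuple R1 :=
  [tuple of xt.1 :: xt.2].

Lemma measurable_tcons : measurable_fun setT tcons.
Proof. exact: measurable_cons. Qed.

Definition cons_measure : set (n.+1.-tuple R1) -> \bar R :=
  pushforward (lebesgue_measure \x mu)%E tcons.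

Let cons_measure0 : cons_measure set0 = 0%E.
Proof. by rewrite /cons_measure /pushforward preimage_set0 measure0. Qed.

Let cons_measure_ge0 A : (0 <= cons_measure A)%E.
Proof. exact: (measure_ge0 (lebesgue_measure \x mu)%E). Qed.

Let cons_measure_sigma_additive : semi_sigma_additive cons_measure.
Proof.
move=> F mF tF mUF; rewrite /cons_measure /pushforward preimage_bigcup.
apply: measure_semi_sigma_additive.
- by move=> k; rewrite -[X in measurable X]setTI; exact: measurable_tcons.
- apply/trivIsetP => /= i j _ _ ij; rewrite -preimage_setI.
  by move/trivIsetP : tF => /(_ _ _ _ _ ij) ->//; rewrite preimage_set0.
- rewrite -preimage_bigcup -[X in measurable X]setTI.
  exact: measurable_tcons.
Qed.

HB.instance Definition _ := isMeasure.Build _ _ _ cons_measure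
  cons_measure0 cons_measure_ge0 cons_measure_sigma_additive.

Let cons_measure_sigma_finite : sigma_finite setT cons_measure.
Proof.
have /sigma_finiteP[F [FT ndF Foo]] := sigma_finiteT (@lebesgue_measure R).
have /sigma_finiteP[G [GT ndG Goo]] := sigma_finiteT mu.
pose g (t : n.+1.-tuple R1) := (thead t, [tuple of behead t]).
have gK : cancel g tcons by move=> t; rewrite /tcons/= [RHS]tuple_eta.
have Kg : cancel tcons g.
  by move=> [x t]; rewrite /g /tcons/= theadE; congr pair; exact/val_inj.
have mg : measurable_fun setT g.
  apply/measurable_fun_pairP; split; last exact: measurable_behead.
  exact: measurable_tnth.
exists (fun k => g @^-1` (F k `*` G k)).
  apply/esym/seteqP; split=> // t _.
  have : (\bigcup_k F k) (g t).1 by rewrite -FT.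
  have : (\bigcup_k G k) (g t).2 by rewrite -GT.
  move=> [j _ Gj] [i _ Fi]; exists (maxn i j) => //; split.
    by move: Fi; apply/subsetPset/ndF/leq_maxl.
  by move: Gj; apply/subsetPset/ndG/leq_maxr.
move=> k; have [mF Fk] := Foo k; have [mG Gk] := Goo k; split.
  by rewrite -[X in measurable X]setTI; apply: mg => //; exact: measurableX.
rewrite /cons_measure /pushforward -comp_preimage.
rewrite (_ : g \o tcons = id) ?preimage_id; last first.
  by apply/funext => x; exact: Kg.
by rewrite product_measure1E// lte_mul_pinfty// ge0_fin_numE.
Qed.

HB.instance Definition _ := Measure_isSigmaFinite.Build _ _ _ cons_measure
  cons_measure_sigma_finite.

End cons_measure.

Fixpoint tuple_lebesgue (R : realType) (n : nat) :
    {sigma_finite_measure set (n.-tuple (measurableTypeR R)) -> \bar R} :=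
  match n with
  | 0 => [the sigma_finite_measure _ _ of
      @dirac _ (0.-tuple (measurableTypeR R)) [tuple] R]
  | m.+1 => [the sigma_finite_measure _ _ of cons_measure (tuple_lebesgue R m)]
  end.

(* R^n carries the sigma-algebra of Lebesgue-measurable sets, obtained as the
   Caratheodory completion of the n-fold product of the Lebesgue measure on R. *)
Definition Rn (R : realType) (n : nat) : Type :=
  caratheodory_type ((tuple_lebesgue R n)^*)%mu.

HB.instance Definition _ (R : realType) (n : nat) := Measurable.on (Rn R n).

Definition lebesgue_Rn (R : realType) (n : nat) : set (Rn R n) -> \bar R :=
  @completed_measure_extension _ _ _ (tuple_lebesgue R n).

HB.instance Definition _ (R : realType) (n : nat) :=
  Measure.on (@lebesgue_Rn R n).

Lemma lebesgue_Rn_sigma_finite (R : realType) (n : nat) :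
  sigma_finite setT (@lebesgue_Rn R n).
Proof. exact/completed_measure_extension_sigma_finite/sigma_finiteT. Qed.

HB.instance Definition _ (R : realType) (n : nat) :=
  @Measure_isSigmaFinite.Build _ _ _ (@lebesgue_Rn R n)
    (@lebesgue_Rn_sigma_finite R n).

Section weighted_morrey.
Context {R : realType} {n : nat}.
Implicit Types (x y : Rn R n) (r p q lam t : R) (f w : Rn R n -> R)
  (g : Rn R n -> \bar R) (A B : set (Rn R n)).
Local Notation mu := (@lebesgue_Rn R n).

Definition edist x y : R :=
  Num.sqrt (\sum_(i < n) (tnth x i - tnth y i) ^+ 2).

Definition eball x r : set (Rn R n) := [set y | edist x y < r].

Definition is_eball B : Prop := exists x r, 0 < r /\ B = eball x r.

(* A measurable function on R^n is locally integrable iff it is integrable on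
   every ball, each compact set being contained in a ball. *)
Definition is_weight w : Prop :=
  [/\ measurable_fun setT w,
      forall B, is_eball B -> mu.-integrable B (EFin \o w) &
      {ae mu, forall x, 0 < w x}].

Local Open Scope ereal_scope.

Definition wmeas w A : \bar R := \int[mu]_(y in A) (w y)%:E.

Definition maximal f x : \bar R :=
  ereal_sup [set (\int[mu]_(y in B) `|f y|%:E) / mu B
            | B in [set B | is_eball B /\ B x]].

Definition morrey_norm p lam w f : \bar R :=
  ereal_sup [set ((r `^ lam)^-1%:E *
                  \int[mu]_(y in eball x r) (`|f y| `^ p * w y)%:E) `^ p^-1
            | x in setT & r in [set r : R | (0 < r)%R]].

Definition morrey p lam w : set (Rn R n -> R) :=
  [set f | measurable_fun setT f /\ morrey_norm p lam w f < +oo].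

(* Stated for extended real-valued functions since maximal f may be infinite. *)
Definition weak_morrey_norm p lam w g : \bar R :=
  ereal_sup [set ((v.2.2 `^ p / v.2.1 `^ lam)%:E *
                  wmeas w (eball v.1 v.2.1 `&` [set y | v.2.2%:E < `|g y|]))
                   `^ p^-1
            | v in [set v : Rn R n * (R * R) | (0 < v.2.1)%R /\ (0 < v.2.2)%R]].

Definition maximal_bounded p lam w : Prop :=
  exists C : R, forall f, morrey p lam w f ->
    weak_morrey_norm p lam w (maximal f) <= C%:E * morrey_norm p lam w f.

Definition A_1 w : Prop :=
  exists c : R, forall B, is_eball B ->
    {ae mu, forall x, B x -> wmeas w B / mu B <= (c * w x)%:E}.

(* Meaningful for 1 < q, where the conjugate exponent is finite. *)
Definition A_gt1 q w : Prop :=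
  let q' := fine (hoelder_conjugate q%:E) in
  ereal_sup [set wmeas w B / mu B *
                 (wmeas (fun y => (w y `^ (1 - q'))%R) B / mu B) `^ (q - 1)
            | B in is_eball] < +oo.

Definition muckenhoupt q w : Prop :=
  (q = 1%R /\ A_1 w) \/ ((1 < q)%R /\ A_gt1 q w).

End weighted_morrey.

(* Main.v *)
Require Import Defs.
From mathcomp Require Import all_boot all_order all_algebra.
From mathcomp Require Import all_classical all_reals all_analysis.
From mathcomp Require Import measurable_realfun ring lra.
(* The Euclidean distance edist has to shadow the extended distance of the same name. *)
Import Defs.

Set Implicit Arguments.
Unset Strict Implicit.
Unset Printing Implicit Defensive.
Import Order.TTheory GRing.Theory Num.Theory.
Import numFieldNormedType.Exports.

Local Open Scope classical_set_scope.
Local Open Scope ring_scope.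

(** Put q = p + lam / n, theta = 1 - lam / n and sigma = w ^ (-1 / (q - 1)).
    If f >= 0 lives on a ball B of radius r, then Mf is at least the average of
    f over B at every point of B, so the weak-type bound gives the testing
    inequality ([weak_type_testing])

      (1/|B| int_B f)^p w(B) r^(-lam) <= C sup_(B') r(B')^(-lam) int_(B') f^p w.

    Its right-hand side is controlled by Hoelder's inequality with exponent
    1 / theta ([integral_powR_le]): the factor |B'|^(lam / n) cancels
    r(B')^(-lam), and what remains is a power of int (f^p w)^(1 / theta).  The
    function f = sigma is the one for which (f^p w)^(1 / theta) = f, since
    p - (q - 1) = theta; the testing inequality then has the same integral
    S = int_B sigma on both sides, and cancelling S^theta leaves

      (w(B) / |B|) (S / |B|)^(q - 1) <= M,

    the A_q condition, with M independent of B because |B| and r^n are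
    comparable ([dual_weight_bound]).

    Cancelling needs S < oo, which is not known beforehand.  So sigma is cut off
    to the sets where w > 0 and sigma <= k, the inequality is proved on these
    with a constant independent of k, and monotone convergence finishes
    ([A_gt1_of_bounded]).

    When q = 1, that is p = 1 and lam = 0, there is no sigma; testing instead on
    the indicator of the part of B where w is less than a fixed fraction of
    w(B) / |B| shows that this part is null ([A_1_of_bounded]). *)

(** * Volumes of balls *)

Section ball_volume.
Context {R : realType}.

Lemma measurable_ball_real (a r : R) : measurable (ball a r : set (measurableTypeR R)).
Proof. by rewrite ball_itv; exact: measurable_itv. Qed.

Definition cube n (x : n.-tuple R) (r : R) : set (n.-tuple (measurableTypeR R)) :=
  [set y | forall i, `|tnth y i - tnth x i| < r].

Lemma measurable_cube n (x : n.-tuple R) (r : R) : measurable (cube x r).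
Proof.
have -> : cube x r = \bigcap_(i in [set: 'I_n])
    ((fun y : n.-tuple (measurableTypeR R) => tnth y i) @^-1`
      [set z | `|z - tnth x i| < r]).
  by apply/seteqP; split => [y hy i _|y hy i]; exact: hy.
apply: fin_bigcap_measurable => // i _.
rewrite -[X in measurable X]setTI; apply: measurable_tnth => //.
rewrite (_ : mkset _ = ball (tnth x i) r); first exact: measurable_ball_real.
by apply/seteqP; split => z /=; rewrite /ball/= distrC.
Qed.

Lemma tuple_lebesgue_cube n (x : n.-tuple R) (r : R) : 0 < r ->
  tuple_lebesgue R n (cube x r) = ((2 * r) ^+ n)%:E.
Proof.
move=> r0; elim: n x => [|n IH] x.
  by rewrite /= diracE mem_set// => -[].
rewrite /= /cons_measure /pushforward.
have -> : @tcons R n @^-1` cube x r =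
    ball (thead x) r `*` cube [tuple of behead x] r.
  rewrite [in LHS](tuple_eta x).
  apply/seteqP; split => [[a y] h|[a y] [/= ha hy] i].
    split => /=; first by have := h ord0; rewrite /ball /= distrC.
    by move=> i; have := h (lift ord0 i); rewrite /= !tnthS.
  rewrite /tcons /=; have [j ->|->] := unliftP ord0 i.
    by rewrite !tnthS; exact: hy.
  by move: ha; rewrite /ball /= distrC.
rewrite product_measure1E; [|exact: measurable_ball_real|exact: measurable_cube].
rewrite IH exprS EFinM; congr (_ * _)%E.
by rewrite mulr_natl -(@lebesgue_measure_ball R (thead x))// ltW.
Qed.

Variable n : nat.
Local Notation mu := (@lebesgue_Rn R n).
Implicit Types (x y : Rn R n) (r : R).

Lemma measurable_lebesgue_Rn (A : set (n.-tuple (measurableTypeR R))) :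
  measurable A -> measurable (A : set (Rn R n)).
Proof. exact: caratheodory_measurable_mu_ext. Qed.

Lemma lebesgue_RnE (A : set (n.-tuple (measurableTypeR R))) :
  measurable A -> mu A = tuple_lebesgue R n A.
Proof. exact: measurable_mu_extE. Qed.

Lemma measurable_eball x r : measurable (eball x r).
Proof.
apply: measurable_lebesgue_Rn.
have mf : measurable_fun [set: n.-tuple (measurableTypeR R)]
    (fun y : n.-tuple (measurableTypeR R) => (edist x (y : Rn R n) : R)).
  rewrite /edist; apply: measurableT_comp => /=.
    exact: (continuous_measurable_fun (@sqrt_continuous R)).
  apply: measurable_sum => i.
  apply: measurable_funX; apply: measurable_funB => //.
  exact: measurable_tnth.
have := mf measurableT `]-oo, r[%classic.
rewrite setTI => /(_ (measurable_itv _)); congr measurable.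
Qed.

Lemma eball_sub_cube x r : eball x r `<=` cube x r.
Proof.
move=> y xyr i; apply: le_lt_trans xyr.
rewrite -sqrtr_sqr ler_wsqrtr// (bigD1 i)//= -sqrrN opprB lerDl.
by apply: sumr_ge0 => *; exact: sqr_ge0.
Qed.

(** Dividing by n + 1 rather than by the square root of n avoids the case
    n = 0 and makes the inclusion in the open ball immediate. *)
Lemma cube_sub_eball x r : 0 < r -> cube x (r / n.+1%:R) `<=` eball x r.
Proof.
move=> r0 y xyr; rewrite /eball/= /edist -[ltRHS](ger0_norm (ltW r0)) -sqrtr_sqr.
rewrite ltr_sqrt ?exprn_gt0//.
apply: (@le_lt_trans _ _ (\sum_(i < n) (r / n.+1%:R) ^+ 2)).
  apply: ler_sum => i _; rewrite -sqrrN opprB -real_normK ?num_real//.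
  by rewrite ler_sqr ?nnegrE// ?divr_ge0 ?(ltW r0)// ltW.
rewrite sumr_const card_ord -[_ *+ n]mulr_natl expr_div_n mulrA ltr_pdivrMr ?exprn_gt0//.
rewrite mulrC ltr_pM2l ?exprn_gt0// -natrX ltr_nat.
by rewrite expnS expn1 mulSn ltnS leq_addr.
Qed.

Lemma eball_volume_le x r : 0 < r -> (mu (eball x r) <= ((2 * r) ^+ n)%:E)%E.
Proof.
move=> r0; rewrite -(tuple_lebesgue_cube x r0) -lebesgue_RnE; last exact: measurable_cube.
apply: le_measure; rewrite ?inE; [exact: measurable_eball| |exact: eball_sub_cube].
exact: (measurable_lebesgue_Rn (measurable_cube x r)).
Qed.

Lemma eball_volume_ge x r : 0 < r ->
  (((2 * (r / n.+1%:R)) ^+ n)%:E <= mu (eball x r))%E.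
Proof.
move=> r0; have rn0 : 0 < r / n.+1%:R by rewrite divr_gt0.
rewrite -(tuple_lebesgue_cube x rn0) -lebesgue_RnE; last exact: measurable_cube.
apply: le_measure; rewrite ?inE; [|exact: measurable_eball|exact: cube_sub_eball].
exact: (measurable_lebesgue_Rn (measurable_cube x _)).
Qed.

Definition vol x r : R := fine (mu (eball x r)).

Lemma volE x r : 0 < r -> mu (eball x r) = (vol x r)%:E.
Proof.
move=> r0; rewrite fineK// ge0_fin_numE//.
by apply: le_lt_trans (eball_volume_le x r0) _; rewrite ltry.
Qed.

Lemma vol_ge x r : 0 < r -> (2 * (r / n.+1%:R)) ^+ n <= vol x r.
Proof. by move=> r0; rewrite -lee_fin -volE// eball_volume_ge. Qed.

Lemma vol_gt0 x r : 0 < r -> 0 < vol x r.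
Proof.
by move=> r0; apply: lt_le_trans (vol_ge x r0); rewrite exprn_gt0// mulr_gt0// divr_gt0.
Qed.

(** The comparability of r^n with |B(x, r)|, in the form in which the powers
    r^lam are absorbed. *)
Lemma radius_powR_le lam x r : 0 <= lam -> (0 < n)%N -> 0 < r ->
  r `^ lam <= (n.+1%:R / 2) `^ lam * vol x r `^ (lam / n%:R).
Proof.
move=> lam0 n0 r0; have nR : (n%:R : R) != 0 by rewrite pnatr_eq0 -lt0n.
have := vol_ge x r0; set u := 2 * (r / n.+1%:R) => uV.
have u0 : 0 < u by rewrite mulr_gt0// divr_gt0.
have rE : r = n.+1%:R / 2 * u.
  rewrite /u; have : (n.+1%:R : R) != 0 by rewrite pnatr_eq0.
  by move: (n.+1%:R : R) => c c0; field.
rewrite [in leLHS]rE powRM ?divr_ge0 ?(ltW u0)// ler_wpM2l ?powR_ge0//.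
rewrite -[leLHS](_ : (u ^+ n) `^ (lam / n%:R) = _); last first.
  by rewrite -powR_mulrn ?(ltW u0)// -powRrM mulrCA divff// mulr1.
by rewrite ge0_ler_powR ?nnegrE ?divr_ge0 ?exprn_ge0 ?(ltW u0) ?(ltW (vol_gt0 x r0)).
Qed.

End ball_volume.

(** * Integral inequalities *)

Lemma ae_integral_ge0 d (T : measurableType d) (R : realType)
    (mu : {measure set T -> \bar R}) (D : set T) (f : T -> \bar R) :
  measurable D -> measurable_fun D f ->
  {ae mu, forall x, (0 <= f x)%E} -> (0 <= \int[mu]_(x in D) f x)%E.
Proof.
move=> mD mf f0; rewrite (ae_eq_integral (fun x => maxe (f x) 0)%E) //.
- by apply: integral_ge0 => x _; rewrite le_max lexx orbT.
- exact: measurable_maxe.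
- by apply: filterS f0 => x f0x _; rewrite max_l.
Qed.

Lemma integral_mul_indic d (T : measurableType d) (R : realType)
    (mu : {measure set T -> \bar R}) (D E : set T) (f : T -> R) :
  (\int[mu]_(x in D) (f x * \1_E x)%:E = \int[mu]_(x in D `&` E) (f x)%:E)%E.
Proof.
rewrite integral_mkcondr; apply: eq_integral => x _.
by rewrite patchE indicE; case: (x \in E); rewrite ?mulr1 ?mulr0.
Qed.

(** For h <= a compare h^t with a^t, and for h > a compare h^(t-1) with
    a^(t-1), using t - 1 <= 0. *)
Lemma powR_le_secant (R : realType) (t a h : R) : 0 < t -> t <= 1 -> 0 < a -> 0 <= h ->
  h `^ t <= a `^ (t - 1) * h + a `^ t.
Proof.
move=> t0 t1 a0 h0; have [ha|ah] := leP h a.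
  rewrite -[leLHS]add0r lerD// ?mulr_ge0 ?powR_ge0//.
  by rewrite ge0_ler_powR ?nnegrE// ltW.
rewrite -[leLHS]addr0 lerD ?powR_ge0// -mulr_powRB1// mulrC ler_wpM2r//.
rewrite -opprB !powRN lef_pV2 ?posrE ?powR_gt0//; last exact: lt_trans ah.
by rewrite ge0_ler_powR ?nnegrE// ?subr_ge0// ltW// (lt_trans a0).
Qed.

(** Hoelder's inequality for h^t on a set of measure at most v, up to the
    factor 2: it comes from integrating [powR_le_secant] at a = S / v, the value
    that balances the two terms.  This form includes the endpoint t = 1, where
    the dual exponent is infinite. *)
Lemma integral_powR_le d (T : measurableType d) (R : realType)
    (mu : {measure set T -> \bar R}) (A : set T) (h : T -> R) (t S v : R) :
  measurable A -> measurable_fun A h -> (forall x, A x -> 0 <= h x) ->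
  0 < t -> t <= 1 -> 0 < S -> 0 < v ->
  (mu A <= v%:E)%E -> (\int[mu]_(x in A) (h x)%:E <= S%:E)%E ->
  (\int[mu]_(x in A) (h x `^ t)%:E <= (2 * (S `^ t * v `^ (1 - t)))%:E)%E.
Proof.
move=> mA mh h0 t0 t1 S0 v0 muv hS; set a := S / v.
have a0 : 0 < a by rewrite divr_gt0.
have mht : measurable_fun A (fun x => (h x `^ t)%:E).
  by apply/measurable_EFinP; apply: (measurableT_comp (measurable_powR _)).
have mah : measurable_fun A (fun x => (a `^ (t - 1) * h x)%:E).
  by apply/measurable_EFinP; exact: measurable_funM.
apply: (@le_trans _ _ (\int[mu]_(x in A)
    ((a `^ (t - 1) * h x)%:E + (a `^ t)%:E))%E).
  apply: ge0_le_integral => //.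
  - by move=> x _; rewrite lee_fin powR_ge0.
  - exact: emeasurable_funD.
  - by move=> x Ax; rewrite -EFinD lee_fin powR_le_secant ?h0.
rewrite ge0_integralD//; last 2 first.
- by move=> x Ax; rewrite lee_fin mulr_ge0 ?powR_ge0 ?h0.
- by move=> x _; rewrite lee_fin powR_ge0.
under eq_integral do rewrite EFinM.
rewrite ge0_integralZl_EFin ?powR_ge0//; last exact/measurable_EFinP.
rewrite integral_cst//.
have -> : 2 * (S `^ t * v `^ (1 - t)) = a `^ (t - 1) * S + a `^ t * v.
  have -> : a `^ (t - 1) * S = a `^ t * v.
    rewrite -[in RHS](mulr_powRB1 (ltW a0) t0) mulrC [in RHS]mulrAC.
    by rewrite /a divfK ?gt_eqF.
  rewrite /a powRM ?invr_ge0 ?(ltW S0) ?(ltW v0)//.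
  rewrite -[v^-1]powR_inv1 ?(ltW v0)// -powRrM mulN1r.
  rewrite powRD ?powRr1 ?(ltW v0)//; last by rewrite (gt_eqF v0) implybT.
  by ring.
by rewrite EFinD !EFinM leeD// lee_pmul2l ?lte_fin ?powR_gt0.
Qed.

(** * The testing inequality *)

Section testing.
Context {R : realType} {n : nat}.
Local Notation mu := (@lebesgue_Rn R n).
Implicit Types (x : Rn R n) (r p lam : R) (w f g : Rn R n -> R)
  (A E : set (Rn R n)).

Lemma wmeas_fin_num w x r : is_weight w -> 0 < r ->
  wmeas w (eball x r) \is a fin_num.
Proof.
move=> [_ wint _] r0; apply: integrable_fin_num; first exact: measurable_eball.
by apply: wint; exists x, r.
Qed.

Lemma wmeas_ge0 w A : is_weight w -> measurable A -> (0 <= wmeas w A)%E.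
Proof.
move=> [mw _ w0] mA; apply: (ae_integral_ge0 mA).
  exact/measurable_EFinP/(measurable_funS measurableT (@subsetT _ _) mw).
by apply: filterS w0 => x /ltW; rewrite lee_fin.
Qed.

Lemma maximal_ge_average f x r y : (forall z, 0 <= f z) ->
  0 < r -> eball x r y ->
  ((\int[mu]_(z in eball x r) (f z)%:E) / mu (eball x r) <= maximal f y)%E.
Proof.
move=> f0 r0 xry; apply: ereal_sup_ubound.
exists (eball x r); first by split => //; exists x, r.
by congr (_ / _)%E; apply: eq_integral => z _; rewrite ger0_norm.
Qed.

Lemma morrey_norm_le p lam w f (K : R) : 0 < p -> is_weight w ->
  measurable_fun setT f -> (forall y, 0 <= f y) -> 0 <= K ->
  (forall x r, 0 < r ->
    (\int[mu]_(y in eball x r) (f y `^ p * w y)%:E <= (K * r `^ lam)%:E)%E) ->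
  (morrey_norm p lam w f <= (K `^ p^-1)%:E)%E.
Proof.
move=> p0 [mw _ w0] mf f0 K0 fK; apply: ge_ereal_sup => _ [x _ [r /= r0] <-].
under eq_integral do rewrite ger0_norm//.
set I := (\int[mu]_(y in _) _)%E.
have I0 : (0 <= I)%E.
  have mfw := measurable_funM (measurableT_comp (measurable_powR p) mf) mw.
  apply: (ae_integral_ge0 (measurable_eball x r)).
    exact/measurable_EFinP/(measurable_funS measurableT (@subsetT _ _) mfw).
  by apply: filterS w0 => y wy; rewrite lee_fin mulr_ge0 ?powR_ge0// ltW.
have rl0 : 0 < r `^ lam by rewrite powR_gt0.
rewrite -poweR_EFin; apply: gt0_ler_poweR.
- by rewrite invr_ge0 ltW.
- by rewrite in_itv/= leey andbT mule_ge0// lee_fin invr_ge0 ltW.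
- by rewrite in_itv/= leey andbT lee_fin.
- have := fK x r r0; rewrite -/I -(@lee_pmul2l _ (r `^ lam)^-1%:E) ?lte_fin ?invr_gt0//.
  by rewrite -EFinM mulrCA mulVf ?mulr1 ?gt_eqF.
Qed.

(** Feed t = S / (2 |B|) to the weak norm: as Mf >= S / |B| > t on B, the level
    set {Mf > t} contains all of B.  The halving of t and the exponent p account
    for the constant (2 C)^p. *)
Lemma weak_type_testing p lam w : 1 <= p -> is_weight w -> maximal_bounded p lam w ->
  exists2 C : R, 0 < C & forall f (K S : R) x r,
    measurable_fun setT f -> (forall y, 0 <= f y) -> 0 <= K ->
    (forall z s, 0 < s ->
      (\int[mu]_(y in eball z s) (f y `^ p * w y)%:E <= (K * s `^ lam)%:E)%E) ->
    0 < r -> 0 < S -> (\int[mu]_(y in eball x r) (f y)%:E)%E = S%:E ->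
    (S / vol x r) `^ p * fine (wmeas w (eball x r)) <= C * K * r `^ lam.
Proof.
move=> p1 hw [C0 hM]; have p0 : 0 < p by apply: lt_le_trans p1.
(* The constant of the hypothesis may be negative. *)
pose C := Num.max C0 1; have C1 : 0 < C by rewrite lt_max ltr01 orbT.
exists ((2 * C) `^ p); first by rewrite powR_gt0// mulr_gt0.
move=> f K S x r mf f0 K0 fK r0 S0 fS.
have V0 := vol_gt0 x r0.
have N := morrey_norm_le p0 hw mf f0 K0 fK.
have /hM : morrey p lam w f by split=> //; apply: le_lt_trans N _; rewrite ltry.
set W := fine _; set V := vol x r in V0 *; set t := S / V.
have WE : wmeas w (eball x r) = W%:E by rewrite fineK// wmeas_fin_num.
have W0 : 0 <= W by rewrite fine_ge0// wmeas_ge0//; exact: measurable_eball.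
have t0 : 0 < t by rewrite divr_gt0.
have rl0 : 0 < r `^ lam by rewrite powR_gt0.
move=> hw1; have {hw1} : ((((t / 2) `^ p / r `^ lam * W) `^ p^-1)%:E
    <= (C * K `^ p^-1)%:E)%E.
  apply: le_trans (le_trans hw1 _); last first.
    apply: (@le_trans _ _ (C%:E * morrey_norm p lam w f)%E).
      apply: lee_wpmul2r; last by rewrite lee_fin le_max lexx.
      apply: le_ereal_sup_tmp; eexists.
        by exists x => //; exists r.
      by rewrite poweR_ge0.
    by rewrite EFinM lee_pmul2l ?lte_fin.
  apply: ereal_sup_ubound; exists (x, (r, t / 2)) => /=.
    by split=> //; rewrite divr_gt0.
  rewrite (_ : eball x r `&` _ = eball x r) ?WE//.
  apply/seteqP; split => [y []//|y xry]; split=> //=.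
  have : (t%:E <= maximal f y)%E.
    apply: le_trans (maximal_ge_average f0 r0 xry).
    by rewrite fS volE// inver gt_eqF// -EFinM.
  move=> tM; apply: lt_le_trans (lee_abs _).
  by apply: lt_le_trans tM; rewrite lte_fin; lra.
rewrite lee_fin => le1.
have := ge0_ler_powR (ltW p0) _ _ le1.
rewrite !nnegrE powR_ge0 mulr_ge0 ?powR_ge0 ?(ltW C1)//.
move=> /(_ isT isT); rewrite (@powRM _ C) ?powR_ge0 ?(ltW C1)// -!powRrM mulVf ?gt_eqF//.
rewrite !powRr1//; last by rewrite mulr_ge0// divr_ge0 ?powR_ge0.
rewrite [t / 2]mulrC powRM ?invr_ge0 ?(ltW t0)//.
rewrite [(2 * C) `^ p]powRM ?(ltW C1)//.
have p20 : 0 < (2 : R) `^ p by rewrite powR_gt0.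
rewrite -powR_inv1// powRAC powR_inv1 ?powR_ge0//.
move=> le2.
have c0 : 0 <= (2 : R) `^ p * r `^ lam by rewrite mulr_ge0 ?powR_ge0.
have := ler_wpM2l c0 le2; congr (_ <= _); last by ring.
by field; rewrite !gt_eqF.
Qed.

(** The test functions are g times the indicator of E; moving E into the domains
    of integration frees the applications from indicators. *)
Lemma weak_type_testing_set p lam w : 1 <= p -> is_weight w -> maximal_bounded p lam w ->
  exists2 C : R, 0 < C & forall g E (K S : R) x r,
    measurable_fun setT g -> (forall y, 0 <= g y) -> measurable E -> 0 <= K ->
    (forall z s, 0 < s ->
      (\int[mu]_(y in eball z s `&` E) (g y `^ p * w y)%:E
        <= (K * s `^ lam)%:E)%E) ->
    0 < r -> E `<=` eball x r -> 0 < S ->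
    (\int[mu]_(y in E) (g y)%:E)%E = S%:E ->
    (S / vol x r) `^ p * fine (wmeas w (eball x r)) <= C * K * r `^ lam.
Proof.
move=> p1 hw hM; have [C C0 hC] := weak_type_testing p1 hw hM; exists C => //.
have p0 : 0 < p by apply: lt_le_trans p1.
move=> g E K S x r mg g0 mE K0 gK r0 Ex S0 gS.
apply: (hC (fun y => g y * \1_E y) K S x r _ _ K0 _ r0 S0).
- by apply: (measurable_funM mg); exact: (measurable_indic mE).
- by move=> y; rewrite mulr_ge0.
- move=> z s s0; apply: le_trans (gK z s s0).
  rewrite -integral_mul_indic le_eqVlt; apply/orP; left; apply/eqP.
  apply: eq_integral => y _; rewrite indicE; case: (y \in E).
    by rewrite !mulr1.
  by rewrite !mulr0 powR0 ?gt_eqF// mul0r.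
- by rewrite integral_mul_indic setIidr.
Qed.

End testing.

(** * The Muckenhoupt conditions *)

Section muckenhoupt.
Context {R : realType} {n : nat}.
Local Notation mu := (@lebesgue_Rn R n).
Implicit Types (x : Rn R n) (r p lam : R) (w : Rn R n -> R) (E : set (Rn R n)).

(** If E is the part of B where 2 C w < w(B) / |B|, then w(E) is at most
    w(B) |E| / (2 C |B|), whereas testing on the indicator of E gives
    w(B) |E| / |B| <= C w(E).  These are incompatible when |E| > 0. *)
Lemma A_1_of_bounded w : is_weight w -> maximal_bounded 1 0 w -> A_1 w.
Proof.
move=> hw hM; have [C C0 hC] := weak_type_testing_set (lexx 1) hw hM.
have [mw _ w0] := hw.
exists (C + C) => _ [x [r [r0 ->]]].
set W := fine (wmeas w (eball x r)); set V := vol x r.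
have V0 : 0 < V := vol_gt0 x r0.
have WE : wmeas w (eball x r) = W%:E by rewrite fineK// wmeas_fin_num.
have mB := measurable_eball x r.
pose E := eball x r `&` [set y | 0 < w y /\ (C + C) * w y < W / V].
have mE : measurable E.
  apply: measurableI => //.
  have mCw : measurable_fun setT (fun y => (C + C) * w y) by exact: measurable_funM.
  have m1 := mw measurableT _ (measurable_itv `]0, +oo[).
  have m2 := mCw measurableT _ (measurable_itv `]-oo, (W / V)[).
  rewrite (_ : mkset _ = (setT `&` w @^-1` `]0, +oo[) `&`
    (setT `&` (fun y => (C + C) * w y) @^-1` `]-oo, (W / V)[)).
    exact: measurableI.
  by apply/seteqP; split => y; rewrite /= !in_itv/= andbT; tauto.
have EV : (mu E <= V%:E)%E.
  by rewrite -volE//; apply: le_measure; rewrite ?inE//; exact: subIsetl.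
have [E0|E0] := eqVneq (mu E) 0%E.
  have nE : {ae mu, forall y, ~ E y}.
    by exists E; split => // y /contrapT.
  apply: filterS2 w0 nE => y wy nEy xry.
  rewrite WE volE// inver gt_eqF// -EFinM lee_fin leNgt; apply/negP => wyW.
  exact: nEy.
have [S SE] : exists S : R, mu E = S%:E.
  by exists (fine (mu E)); rewrite fineK// ge0_fin_numE// (le_lt_trans EV)// ltry.
have S0 : 0 < S by rewrite -lte_fin -SE lt0e E0/=.
have CC0 : 0 < C + C by rewrite addr_gt0.
have W0 : 0 < W.
  have [E00|/set0P[y [_ [wy0 wyW]]]] := eqVneq E set0.
    by move: E0; rewrite E00 measure0 eqxx.
  have : 0 < W / V by apply: lt_trans wyW; rewrite mulr_gt0.
  by rewrite pmulr_lgt0// invr_gt0.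
have := hC (cst 1) E (W / V / (C + C) * S) S x r.
have K0 : 0 <= W / V / (C + C) by rewrite !divr_ge0// ltW.
have mwE : measurable_fun E (fun y => (w y)%:E).
  exact/measurable_EFinP/(measurable_funS measurableT (@subsetT _ _) mw).
have wE z s : 0 < s -> (\int[mu]_(y in eball z s `&` E) (cst 1 y `^ 1 * w y)%:E
        <= (W / V / (C + C) * S * s `^ 0)%:E)%E.
  move=> s0; rewrite powRr0 mulr1.
  under eq_integral do rewrite powRr1// mul1r.
  apply: (@le_trans _ _ (\int[mu]_(y in E) (w y)%:E)%E).
    apply: (ge0_subset_integral _ (measurableI _ _ (measurable_eball z s) mE) mE).
    - exact: mwE.
    - by move=> y [_ [/ltW]]; rewrite lee_fin.
    - exact: subIsetr.
  apply: (@le_trans _ _ (\int[mu]_(y in E) (cst (W / V / (C + C))%:E y))%E).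
    apply: ge0_le_integral; first exact: mE.
    - by move=> y [_ [/ltW]]; rewrite lee_fin.
    - exact: mwE.
    - exact: measurable_cst.
    - by move=> y [_ [_ /ltW wyW]]; rewrite /= lee_fin ler_pdivlMr// mulrC.
  by rewrite integral_cst// [X in (_ * X <= _)%E]SE -EFinM.
have E1 : (\int[mu]_(y in E) (cst 1 y)%:E)%E = S%:E.
  by rewrite -SE -[RHS]mul1e; exact: (integral_cst mu mE 1%:E).
move=> /(_ (measurable_cst _) (fun _ => ler01) mE).
rewrite mulr_ge0// ?(ltW S0)// => /(_ isT wE r0 (@subIsetl _ _ _) S0 E1).
rewrite powRr0 mulr1 powRr1 -/W -/V; last by rewrite divr_ge0 ?ltW.
have -> : C * (W / V / (C + C) * S) = 2^-1 * (S / V * W).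
  by field; rewrite !gt_eqF.
have : 0 < S / V * W by rewrite mulr_gt0// divr_gt0.
by move=> *; exfalso; lra.
Qed.

(** Testing on sigma = w^(-1/b) over E, where b = q - 1.  Since sigma^p w =
    sigma^t on E with t = p - b = 1 - lam / n, [integral_powR_le] bounds the
    Morrey norm by a power of the integral S of sigma, and S^t cancels.  The
    finiteness of S is what makes this cancellation legitimate. *)
Lemma dual_weight_bound p lam w (b := p + lam / n%:R - 1) :
  1 <= p -> 0 <= lam -> lam < n%:R -> 0 < b ->
  is_weight w -> maximal_bounded p lam w ->
  exists2 M : R, 0 < M & forall x r E (S : R), 0 < r -> measurable E ->
    E `<=` eball x r -> (forall y, E y -> 0 < w y) ->
    (\int[mu]_(y in E) (w y `^ (- b^-1))%:E)%E = S%:E ->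
    fine (wmeas w (eball x r)) / vol x r * (S / vol x r) `^ b <= M.
Proof.
move=> p1 lam0 lamn b0 hw hM; have [C C0 hC] := weak_type_testing_set p1 hw hM.
have [mw _ w0] := hw.
have nR : (0 : R) < n%:R by apply: le_lt_trans lamn.
have n0 : (0 < n)%N by move: nR; rewrite ltr0n.
pose t := 1 - lam / n%:R.
have t0 : 0 < t by rewrite subr_gt0 ltr_pdivrMr// mul1r.
have t1 : t <= 1 by rewrite gerBl divr_ge0// ltW.
have t1E : 1 - t = lam / n%:R by rewrite /t; ring.
have pE : p = b + t by rewrite /b /t; ring.
have c0 : (0 : R) < n.+1%:R / 2 by rewrite divr_gt0.
exists (C * (2 * 2 `^ lam) * (n.+1%:R / 2) `^ lam).
  by rewrite !mulr_gt0 ?powR_gt0.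
move=> x r E S r0 mE Ex Ew ES.
set W := fine _; set V := vol x r; have V0 : 0 < V := vol_gt0 x r0.
have S0 : 0 <= S.
  by rewrite -lee_fin -ES; apply: integral_ge0 => y _; rewrite lee_fin powR_ge0.
have [->|Sn0] := eqVneq S 0.
  by rewrite mul0r powR0 ?gt_eqF// mulr0 !mulr_ge0 ?powR_ge0 ?(ltW C0).
have {Sn0}S0 : 0 < S by rewrite lt_neqAle eq_sym Sn0.
pose sig y := w y `^ (- b^-1).
have msig : measurable_fun setT sig by exact: (measurableT_comp (measurable_powR _)).
have sig0 y : 0 <= sig y by exact: powR_ge0.
have wE z s : 0 < s -> (\int[mu]_(y in eball z s `&` E) (sig y `^ p * w y)%:E
    <= (2 * 2 `^ lam * S `^ t * s `^ lam)%:E)%E.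
  move=> s0; have mzE : measurable (eball z s `&` E).
    by apply: measurableI => //; exact: measurable_eball.
  (* sig ^ (- b) = w gives sig ^ p * w = sig ^ (p - b) = sig ^ t *)
  rewrite (eq_integral (fun y => (sig y `^ t)%:E)); last first.
    move=> y; rewrite inE => -[_ /Ew wy]; congr EFin.
    rewrite pE powRD; last by rewrite (gt_eqF (powR_gt0 _ wy)) implybT.
    rewrite /sig -(powRrM _ _ b) mulNr mulVf ?gt_eqF// powR_inv1 ?(ltW wy)//.
    by rewrite mulrAC mulVf ?mul1r// gt_eqF.
  have v0 : 0 < (2 * s) ^+ n by rewrite exprn_gt0// mulr_gt0.
  have vle : (mu (eball z s `&` E) <= ((2 * s) ^+ n)%:E)%E.
    apply: le_trans (eball_volume_le z s0).
    by apply: le_measure; rewrite ?inE//; exact: measurable_eball.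
  have Sle : (\int[mu]_(y in eball z s `&` E) (sig y)%:E <= S%:E)%E.
    rewrite -ES; apply: (ge0_subset_integral _ mzE mE).
    - exact/measurable_EFinP/(measurable_funS measurableT (@subsetT _ _) msig).
    - by move=> y _; rewrite lee_fin.
    - exact: subIsetr.
  have msE := measurable_funS measurableT (@subsetT _ (eball z s `&` E)) msig.
  apply: le_trans (integral_powR_le mzE msE (fun y _ => sig0 y) t0 t1 S0 v0 vle Sle) _.
  rewrite lee_fin t1E -powR_mulrn ?mulr_ge0 ?(ltW s0)// -powRrM (mulrCA n%:R).
  rewrite divff ?gt_eqF// mulr1 powRM ?(ltW s0)//.
  by rewrite le_eqVlt; apply/orP; left; apply/eqP; ring.
have K0 : 0 <= 2 * 2 `^ lam * S `^ t by rewrite !mulr_ge0 ?powR_ge0.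
have := hC sig E _ S x r msig sig0 mE K0 wE r0 Ex S0 ES.
rewrite -/W -/V; set a := S / V; have a0 : 0 < a by rewrite divr_gt0.
have -> : S = a * V by rewrite /a divfK// gt_eqF.
rewrite pE powRD; last by rewrite (gt_eqF a0) implybT.
rewrite powRM ?(ltW a0) ?(ltW V0)// => le1.
(* In terms of the average a = S / V, the factor to cancel is a ^ t. *)
have at0 : 0 < a `^ t by rewrite powR_gt0.
have Vt : V = V `^ t * V `^ (1 - t).
  rewrite -powRD; last by rewrite (gt_eqF V0) implybT.
  by rewrite addrC subrK powRr1 ?(ltW V0).
rewrite mulrAC ler_pdivrMr// -(ler_pM2r at0).
have -> : W * a `^ b * a `^ t = a `^ b * a `^ t * W by ring.
apply: le_trans le1 _; rewrite [X in _ <= _ * X * _]Vt.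
have := radius_powR_le x lam0 n0 r0; rewrite -/V -t1E => le2.
have D0 : 0 <= C * (2 * 2 `^ lam * (a `^ t * V `^ t)).
  by rewrite !mulr_ge0 ?powR_ge0 ?(ltW C0).
have := ler_wpM2l D0 le2.
by congr (_ <= _); ring.
Qed.

(** On the sets F k where w > 0 and sigma <= k the integrals of sigma are finite,
    so [dual_weight_bound] applies and, solved for the integral, bounds it by
    |B| L with L = (M |B| / w(B)) ^ (1 / b), uniformly in k.  The F k exhaust B
    up to a null set. *)
Lemma A_gt1_of_bounded p lam w :
  1 <= p -> 0 <= lam -> lam < n%:R -> 1 < p + lam / n%:R ->
  is_weight w -> maximal_bounded p lam w -> A_gt1 (p + lam / n%:R) w.
Proof.
move=> p1 lam0 lamn q1 hw hM; set q := _ + _ in q1 *.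
have b0 : 0 < q - 1 by rewrite subr_gt0.
have [M M0 hMb] := dual_weight_bound p1 lam0 lamn b0 hw hM.
rewrite -/q in hMb; have [mw _ w0] := hw.
rewrite /A_gt1.
have -> : 1 - fine (hoelder_conjugate q%:E) = - (q - 1)^-1.
  rewrite /hoelder_conjugate/= !eqe gt_eqF ?(lt_trans _ q1)//.
  rewrite -EFinD inver gt_eqF// -EFinM /=.
  by field; rewrite gt_eqF.
apply: (@le_lt_trans _ _ M%:E); last by rewrite ltry.
apply: ge_ereal_sup => _ [_ [x [r [r0 ->]]] <-].
set b := q - 1 in b0 hMb *; pose sig y := w y `^ (- b^-1).
have msig : measurable_fun setT sig by exact: (measurableT_comp (measurable_powR _)).
have sig0 y : 0 <= sig y by exact: powR_ge0.
have mB := measurable_eball x r.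
have WE : wmeas w (eball x r) = (fine (wmeas w (eball x r)))%:E.
  by rewrite fineK// wmeas_fin_num.
have W0 : 0 <= fine (wmeas w (eball x r)) by rewrite fine_ge0// wmeas_ge0.
move: (hMb x r) WE W0; set W := fine _; set V := vol x r => {}hMb WE W0.
have V0 : 0 < V := vol_gt0 x r0.
have VE : mu (eball x r) = V%:E := volE x r0.
rewrite WE VE inver gt_eqF// -EFinM.
have [->|Wn0] := eqVneq W 0; first by rewrite mul0r mul0e lee_fin ltW.
have {Wn0}W0 : 0 < W by rewrite lt_neqAle eq_sym Wn0.
have WV0 : 0 < W / V by rewrite divr_gt0.
pose L := (M / (W / V)) `^ b^-1.
have L0 : 0 <= L by exact: powR_ge0.
pose F k := eball x r `&` [set y | 0 < w y /\ sig y <= k%:R].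
have mF k : measurable (F k).
  apply: measurableI => //.
  have m1 := mw measurableT _ (measurable_itv `]0, +oo[).
  have m2 := msig measurableT _ (measurable_itv `]-oo, k%:R]).
  rewrite (_ : mkset _ = (setT `&` w @^-1` `]0, +oo[) `&`
    (setT `&` sig @^-1` `]-oo, k%:R])); first exact: measurableI.
  by apply/seteqP; split => y; rewrite /= !in_itv/= andbT; tauto.
have FL k : (\int[mu]_(y in F k) (sig y)%:E <= (V * L)%:E)%E.
  have fin : (\int[mu]_(y in F k) (sig y)%:E < +oo)%E.
    apply: (@le_lt_trans _ _ (\int[mu]_(y in F k) (cst k%:R%:E y))%E).
      apply: ge0_le_integral; first exact: mF.
      - by move=> y _; rewrite lee_fin.
      - exact/measurable_EFinP/(measurable_funS measurableT (@subsetT _ _) msig).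
      - exact: measurable_cst.
      - by move=> y [_ [_]]; rewrite lee_fin.
    rewrite integral_cst// lte_mul_pinfty// (@le_lt_trans _ _ V%:E) ?ltry//.
    by rewrite -VE; apply: le_measure; rewrite ?inE//; exact: subIsetl.
  have I0 : (0 <= \int[mu]_(y in F k) (sig y)%:E)%E.
    by apply: integral_ge0 => y _; rewrite lee_fin.
  have := hMb (F k) (fine (\int[mu]_(y in F k) (sig y)%:E)%E) r0 (mF k) (@subIsetl _ _ _).
  set S := (\int[mu]_(y in F k) _)%E in fin I0 *.
  have SE : S = (fine S)%:E by rewrite fineK// ge0_fin_numE.
  move=> /(_ _ SE) => /(_ (fun y Fy => Fy.2.1)).
  have s0 : 0 <= fine S by rewrite fine_ge0.
  rewrite [in X in _ -> X]SE lee_fin; move: (fine S) s0 => s s0.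
  rewrite mulrC -ler_pdivlMr// => le1.
  rewrite mulrC -ler_pdivrMr//.
  have := ge0_ler_powR (ltW (_ : 0 < b^-1)) _ _ le1.
  rewrite invr_gt0 -powRrM divff ?gt_eqF// powRr1 ?divr_ge0 ?(ltW V0)//.
  by apply => //; rewrite nnegrE ?powR_ge0// divr_ge0 ?ltW.
have FB : \bigcup_k F k = eball x r `&` [set y | 0 < w y].
  apply/seteqP; split => [y [k _ [? []]]//|y [xry wy]].
  by exists (Num.truncn (sig y)).+1 => //; split=> //; split=> //; exact/ltW/truncnS_gt.
have sigL : (wmeas sig (eball x r) <= (V * L)%:E)%E.
  have -> : wmeas sig (eball x r) = (\int[mu]_(y in \bigcup_k F k) (sig y)%:E)%E.
    rewrite FB /wmeas -integral_mul_indic.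
    apply: ae_eq_integral; first exact: mB.
    - exact/measurable_EFinP/(measurable_funS measurableT (@subsetT _ _) msig).
    - apply/measurable_EFinP/measurable_funM.
        exact: (measurable_funS measurableT (@subsetT _ _) msig).
      apply: measurable_indic.
      have := mw measurableT _ (measurable_itv `]0, +oo[).
      by rewrite setTI; congr measurable; apply/seteqP; split=> y; rewrite /= in_itv/= andbT.
    - apply: filterS w0 => y wy _.
      by rewrite indicE mem_set// mulr1.
  have cvgF : (\int[mu]_(y in F k) (sig y)%:E)%E @[k --> \oo] -->
      (\int[mu]_(y in \bigcup_k F k) (sig y)%:E)%E.
    apply: ge0_nondecreasing_set_cvg_integral.
    - move=> i j ij; apply/subsetPset => y [xry [wy sy]]; split=> //; split=> //.
      by apply: le_trans sy _; rewrite ler_nat.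
    - exact: mF.
    - move=> k.
      exact/measurable_EFinP/(measurable_funS measurableT (@subsetT _ _) msig).
    - by move=> k y _; rewrite lee_fin.
  by apply: cvge_le cvgF; exact: nearW.
have sigI0 : (0 <= wmeas sig (eball x r))%E.
  by apply: integral_ge0 => y _; rewrite lee_fin.
apply: (@le_trans _ _ ((W / V)%:E * (L `^ b)%:E)%E); last first.
  rewrite -EFinM lee_fin /L -powRrM mulVf ?gt_eqF// powRr1; last first.
    by rewrite !divr_ge0 ?(ltW M0) ?(ltW W0) ?(ltW V0).
  by rewrite mulrC divfK// gt_eqF.
rewrite lee_pmul2l ?lte_fin// -poweR_EFin.
have sV0 : (0 <= wmeas sig (eball x r) * (V^-1)%:E)%E.
  by rewrite mule_ge0// lee_fin invr_ge0 ltW.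
apply: gt0_ler_poweR; rewrite ?(ltW b0)// ?in_itv/= ?leey ?andbT//.
by rewrite lee_pdivrMr// -EFinM mulrC.
Qed.

End muckenhoupt.

Theorem proposition5p2 (R : realType) (n : nat) (p lam : R) (w : Rn R n -> R)
    (hp : 1 <= p) (hlam0 : 0 <= lam) (hlamn : lam < n%:R)
    (hw : is_weight w) (hM : maximal_bounded p lam w) :
  muckenhoupt (p + lam / n%:R) w.
Proof.
have n0 : (0 : R) < n%:R by apply: le_lt_trans hlamn.
have ln0 : 0 <= lam / n%:R by rewrite divr_ge0// ltW.
have [q1|q1] := ltP 1 (p + lam / n%:R).
  by right; split=> //; exact: A_gt1_of_bounded.
have pE : p = 1 by lra.
have lamE : lam = 0.
  have : lam / n%:R = 0 by lra.
  by move/eqP; rewrite mulf_eq0 invr_eq0 [n%:R == 0]gt_eqF// orbF => /eqP.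
rewrite pE lamE in hM *; left; split; first by rewrite mul0r addr0.
exact: A_1_of_bounded.
Qed.
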